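(* Let $\mathbf{v}_i,\mathbf{w}_i\in\mathbb{R}^{n^i}$, $i=2,\dots,d$, be the vectors of polynomial coefficients of the past and future energy functions $$\mathcal{E}_\gamma^-(\mathbf{x})=\tfrac12\sum_{i=2}^{d}\mathbf{v}_i^\top\mathbf{x}^{\otimes i},\qquad \mathcal{E}_\gamma^+(\mathbf{x})=\tfrac12\sum_{i=2}^{d}\mathbf{w}_i^\top\mathbf{x}^{\otimes i},\qquad \mathbf{x}\in\mathbb{R}^n .$$ Let $\mathbf{L},\mathbf{R}$ be Cholesky factors of $\mathbf{W}_2=\mathrm{unvec}(\mathbf{w}_2)$ and $\mathbf{V}_2=\mathrm{unvec}(\mathbf{v}_2)$, i.e., $\mathbf{W}_2=\mathbf{L}\mathbf{L}^\top$ and $\mathbf{V}_2=\mathbf{R}\mathbf{R}^\top$, and compute the singular value decomposition $\mathbf{L}^\top\mathbf{R}^{-\top}=\mathcal{U}\,\mathbf{\Xi}\,\mathcal{V}^\top$. Consider the input-normal/output-diagonal transformation $\mathbf{x}=\Phi(\mathbf{z})=\mathbf{T}_1\mathbf{z}+\mathbf{T}_2\mathbf{z}^{\otimes2}+\cdots$ with polynomial coefficients $\mathbf{T}_j\in\mathbb{R}^{n\times n^j}$, as described in the context. The linear part $\mathbf{T}_1$ and its inverse are given by $$\mathbf{T}_1=\mathbf{R}^{-\top}\mathcal{V}\in\mathbb{R}^{n\times n},\qquad \mathbf{T}_1^{-1}=\mathbf{\Xi}^{-1}\mathcal{U}^\top\mathbf{L}^\top\in\mathbb{R}^{n\times n},$$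 and they satisfy $\mathbf{T}_1^\top\mathbf{V}_2\mathbf{T}_1=\mathbf{I}$ (input-normal) and $\mathbf{T}_1^\top\mathbf{W}_2\mathbf{T}_1=\mathbf{\Xi}^2$ (output-diagonal). Moreover, $\mathbf{T}_1^{-1}\mathbf{V}_2^{-1}\mathbf{W}_2\mathbf{T}_1=\mathbf{\Xi}^2$, i.e., $\mathbf{V}_2^{-1}\mathbf{W}_2$ is similar to $\mathbf{\Xi}^2$. Thus, $\mathbf{T}_1$ is the well-known input-normal/output-diagonal transformation for the linearized system. The higher-degree tensors of the nonlinear transformation $\Phi$, for $k\ge2$, take the form $$\mathbf{T}_k=-\tfrac12\,\mathbf{T}_1\,\mathrm{unvec}(\mathbf{M}_k)^\top\in\mathbb{R}^{n\times n^k},\qquad \mathbf{M}_k=\sum_{\substack{i,j>1\\ i+j=k+1}}\mathrm{vec}\big(\mathbf{T}_j^\top\mathbf{V}_2\mathbf{T}_i\big)+\sum_{i=3}^{k+1}\mathcal{T}_{i,k+1}^\top\mathbf{v}_i .$$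
   Context: System and energies: $\dot{\mathbf{x}}=\mathbf{f}(\mathbf{x})+\mathbf{g}(\mathbf{x})\mathbf{u}$, $\mathbf{y}=\mathbf{h}(\mathbf{x})$, with state $\mathbf{x}(t)\in\mathbb{R}^n$ and isolated equilibrium $\mathbf{x}=\mathbf{0}$ for $\mathbf{u}=\mathbf{0}$. For $\gamma>0$, $\gamma\ne1$, the past energy $\mathcal{E}_\gamma^-(\mathbf{x}_0)$ is the minimum of $\frac12\int_{-\infty}^0(1-\gamma^{-2})\|\mathbf{y}\|^2+\|\mathbf{u}\|^2\,dt$ over $\mathbf{u}\in L_2(-\infty,0]$ with $\mathbf{x}(-\infty)=\mathbf{0}$, $\mathbf{x}(0)=\mathbf{x}_0$; the future energy $\mathcal{E}_\gamma^+(\mathbf{x}_0)$ is the minimum (if $\gamma>1$) or maximum (if $0<\gamma<1$) of $\frac12\int_0^\infty\|\mathbf{y}\|^2+\frac{\|\mathbf{u}\|^2}{1-\gamma^{-2}}\,dt$ over $\mathbf{u}\in L_2[0,\infty)$ with $\mathbf{x}(0)=\mathbf{x}_0$, $\mathbf{x}(\infty)=\mathbf{0}$. Both are assumed to be polynomial (or approximated as such), with symmetric coefficients: $\mathbf{v}_i^\top(\mathbf{a}_1\otimes\cdots\otimes\mathbf{a}_i)$ and $\mathbf{w}_i^\top(\mathbf{a}_1\otimes\cdots\otimes\mathbf{a}_i)$ are invariant under all permutations of $\mathbf{a}_1,\dots,\mathbf{a}_i\in\mathbb{R}^n$. The matrices $\mathbf{V}_2,\mathbf{W}_2\in\mathbb{R}^{n\times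 n}$ are symmetric positive definite: $\mathbf{V}_2^{-1}$ and $\mathbf{W}_2$ are the stabilizing solutions of the $\mathcal{H}_\infty$ filter and control algebraic Riccati equations of the linearized system. Transformation: $\Phi$ is a smooth coordinate transformation $\mathbf{x}=\Phi(\mathbf{z})$ near the origin, assumed analytic and written (or approximated) as the polynomial above with $\mathbf{T}_1$ nonsingular, that brings the energies into input-normal/output-diagonal form $$\mathcal{E}_\gamma^-(\Phi(\mathbf{z}))=\tfrac12\sum_{i=1}^n z_i^2,\qquad \mathcal{E}_\gamma^+(\Phi(\mathbf{z}))=\tfrac12\sum_{i=1}^n\xi_i^2(z_i)\,z_i^2,$$ where $\xi_i$ are the singular value functions. Its coefficients are determined by inserting the expansion of $\Phi$ into these identities and matching polynomial coefficients. Notation: $\mathbf{x}^{\otimes k}\in\mathbb{R}^{n^k}$ is the $k$-fold Kronecker product; $\mathrm{vec}$ stacks columns and $\mathrm{unvec}$ is its inverse, with $\mathrm{unvec}(\mathbf{v}_2),\mathrm{unvec}(\mathbf{w}_2)\in\mathbb{R}^{n\times n}$ and $\mathrm{unvec}(\mathbf{M}_k)\in\mathbb{R}^{n^k\times n}$; $\mathcal{U},\mathcal{V}$ are orthogonal and $\mathbf{\Xi}=\mathrm{diag}(\xi_1(0),\dots,\xi_n(0))$ is the diagonal matrix of singular values. For $l\ge m\ge1$, $$\mathcal{T}_{m,l}=\sum_{\substack{i_1,\dots,i_m\ge1\\ i_1+\cdots+i_m=l}}\mathbf{T}_{i_1}\otimes\cdots\otimes\mathbf{T}_{i_m}\in\mathbb{R}^{n^m\times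 n^l}.$$ Coefficients $\mathbf{v}_i$ with $i>d$ are taken to be zero.
   Formalization: The T_k formula is false for general Φ (both energies multiples of |x|², Φ a z-dependent rotation). Proved: the formula yields an input-normal series; any Φ has T_k = formula + T_1 N with z^T N z^{⊗k} = 0, and T_1 = R^{-T}V for a suitable SVD. *)

(* Defs.v *)
From HB Require Import structures.
From mathcomp Require Import all_boot all_order all_algebra perm.
From mathcomp Require Import mxtens complex.
From mathcomp Require Import all_classical all_reals all_analysis.

Set Implicit Arguments.
Unset Strict Implicit.
Unset Printing Implicit Defensive.

Import Order.TTheory GRing.Theory Num.Theory.
Import numFieldNormedType.Exports.
Local Open Scope classical_set_scope.
Local Open Scope ring_scope.

(* The Kronecker product is [tensmx] (notation [*t]); index (i, j) of a product
   of dimensions (a, b) is [mxtens_index (i, j)], of value i * b + j.           *)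

Section Vectorization.
Variable R : realType.

(* Column stacking: entry j * a + i of [vec A] is A i j. *)
Definition vec (a b : nat) (A : 'M[R]_(a, b)) : 'cV[R]_(b * a) :=
  \col_k A (mxtens_unindex k).2 (mxtens_unindex k).1.

Definition unvec (a b : nat) (v : 'cV[R]_(b * a)) : 'M[R]_(a, b) :=
  \matrix_(i, j) v (mxtens_index (j, i)) 0.

End Vectorization.

Section KroneckerPowers.
Variables (R : realType) (n : nat).

(* a_0 (x) ... (x) a_{k-1} *)
Fixpoint kronv (k : nat) : ('I_k -> 'cV[R]_n) -> 'cV[R]_(n ^ k) :=
  match k with
  | 0 => fun _ => const_mx 1
  | k'.+1 => fun a =>
      castmx (esym (expnS n k'), erefl 1%N)
        (a ord0 *t kronv (fun j => a (lift ord0 j)))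
  end.

Definition kpow (z : 'cV[R]_n) (k : nat) : 'cV[R]_(n ^ k) :=
  kronv (fun _ : 'I_k => z).

(* v^T (a_0 (x) ... (x) a_{k-1}) is invariant under permutations of the a_j. *)
Definition symmetric_coef (k : nat) (v : 'cV[R]_(n ^ k)) : Prop :=
  forall (a : 'I_k -> 'cV[R]_n) (s : 'S_k),
    v^T *m kronv (fun j => a (s j)) = v^T *m kronv a.

Definition poly_energy (d : nat) (v : forall i, 'cV[R]_(n ^ i))
    (x : 'cV[R]_n) : R :=
  2^-1 * \sum_(2 <= i < d.+1) ((v i)^T *m kpow x i) 0 0.

(* The quadratic coefficient as a matrix; n ^ 2 is convertible to n * n. *)
Definition quad_mx (v : forall i, 'cV[R]_(n ^ i)) : 'M[R]_n :=
  @unvec R n n (v 2%N).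

Variable T : forall k : nat, 'M[R]_(n, n ^ k).

(* T_{i_1} (x) ... (x) T_{i_m} for s = [:: i_1; ...; i_m] *)
Fixpoint kronT (s : seq nat) : 'M[R]_(n ^ size s, n ^ sumn s) :=
  match s with
  | [::] => const_mx 1
  | i :: s' =>
      castmx (esym (expnS n (size s')), esym (expnD n i (sumn s')))
        (T i *t kronT s')
  end.

(* The sum runs over the compositions of l into m positive parts; for these
   [kronT] has dimensions n^m x n^l up to a propositional equality, which
   [conform_mx] transports along, so that the default 0 is never used.        *)
Definition calT (m l : nat) : 'M[R]_(n ^ m, n ^ l) :=
  \sum_(t : m.-tuple 'I_l.+1 |
          all (fun i : 'I_l.+1 => (0 < i)%N) t
          && (sumn (map (@nat_of_ord l.+1) t) == l))
     conform_mx 0 (kronT (map (@nat_of_ord l.+1) t)).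

(* As above, [conform_mx] only identifies n^i * n^j with n^(k+1). *)
Definition Mvec (v : forall i, 'cV[R]_(n ^ i)) (k : nat) : 'cV[R]_(n ^ k.+1) :=
  \sum_(i < k.+2) \sum_(j < k.+2 | [&& (1 < i)%N, (1 < j)%N & (i + j == k.+1)%N])
     conform_mx 0 (vec ((T j)^T *m quad_mx v *m T i))
  + \sum_(3 <= i < k.+2) (calT i k.+1)^T *m v i.

Definition Mmx (v : forall i, 'cV[R]_(n ^ i)) (k : nat) : 'M[R]_(n ^ k, n) :=
  unvec (castmx (expnS n k, erefl 1%N) (Mvec v k)).

End KroneckerPowers.

Section Energies.
Variables (R : realType) (n m p : nat).
Variables (f : 'cV[R]_n -> 'cV[R]_n) (g : 'cV[R]_n -> 'M[R]_(n, m))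
          (h : 'cV[R]_n -> 'cV[R]_p).

Definition isolated_equilibrium : Prop :=
  f 0 = 0 /\ \forall x \near (0 : 'cV[R]_n), f x = 0 -> x = 0.

Definition sqnorm (q : nat) (a : 'cV[R]_q) : R := \sum_i a i 0 ^+ 2.

Definition L2 (D : set R) (u : R -> 'cV[R]_m) : Prop :=
  forall j, measurable_fun D (fun t => u t j 0) /\
    (@lebesgue_measure R).-integrable D (fun t => (u t j 0 ^+ 2)%:E).

(* Caratheodory solution on the interval D of x' = f(x) + g(x) u. *)
Definition trajectory (D : set R) (u : R -> 'cV[R]_m) (x : R -> 'cV[R]_n) :
    Prop :=
  forall s t, D s -> D t -> s <= t -> forall i,
    let F := fun r => (f (x r) + g (x r) *m u r) i 0 in
    (@lebesgue_measure R).-integrable `[s, t] (EFin \o F) /\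
    x t i 0 = x s i 0 + \int[@lebesgue_measure R]_(r in `[s, t]) F r.

Variable gamma : R.

Definition past_admissible (x0 : 'cV[R]_n) (u : R -> 'cV[R]_m)
    (x : R -> 'cV[R]_n) : Prop :=
  [/\ L2 `]-oo, 0%R] u, trajectory `]-oo, 0%R] u x,
      x t @[t --> -oo] --> (0 : 'cV[R]_n) & x 0 = x0].

(* For u in L^2 at most one of the positive and negative parts of the
   integrand has infinite integral, so the cost is a well-defined extended
   real; likewise for [future_cost].                                        *)
Definition past_cost (u : R -> 'cV[R]_m) (x : R -> 'cV[R]_n) : \bar R :=
  (2^-1%:E * \int[@lebesgue_measure R]_(t in `]-oo, 0%R])
     ((1 - gamma ^- 2) * sqnorm (h (x t)) + sqnorm (u t))%:E)%E.

Definition is_past_energy (x0 : 'cV[R]_n) (e : R) : Prop :=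
  (exists u x, past_admissible x0 u x /\ past_cost u x = e%:E) /\
  (forall u x, past_admissible x0 u x -> (e%:E <= past_cost u x)%E).

Definition future_admissible (x0 : 'cV[R]_n) (u : R -> 'cV[R]_m)
    (x : R -> 'cV[R]_n) : Prop :=
  [/\ L2 `[0%R, +oo[ u, trajectory `[0%R, +oo[ u x,
      x 0 = x0 & x t @[t --> +oo] --> (0 : 'cV[R]_n)].

Definition future_cost (u : R -> 'cV[R]_m) (x : R -> 'cV[R]_n) : \bar R :=
  (2^-1%:E * \int[@lebesgue_measure R]_(t in `[0%R, +oo[)
     (sqnorm (h (x t)) + sqnorm (u t) / (1 - gamma ^- 2))%:E)%E.

Definition is_future_energy (x0 : 'cV[R]_n) (e : R) : Prop :=
  (exists u x, future_admissible x0 u x /\ future_cost u x = e%:E) /\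
  (forall u x, future_admissible x0 u x ->
     if 1 < gamma then (e%:E <= future_cost u x)%E
     else (future_cost u x <= e%:E)%E).

Definition hurwitz (A : 'M[R]_n) : Prop :=
  forall l : R[i], eigenvalue (map_mx (real_complex R) A) l -> complex.Re l < 0.

Definition linearization (A : 'M[R]_n) (C : 'M[R]_(p, n)) : Prop :=
  [/\ differentiable f 0, forall dx, 'd f 0 dx = A *m dx,
      differentiable h 0 & forall dx, 'd h 0 dx = C *m dx].

(* H-infinity filter Riccati equation of the linearization (A, B, C), B = g 0. *)
Definition filter_are_stabilizing (A : 'M[R]_n) (C : 'M[R]_(p, n))
    (Y : 'M[R]_n) : Prop :=
  let B := g 0 in
  A *m Y + Y *m A^T + B *m B^T
    - (1 - gamma ^- 2) *: (Y *m C^T *m C *m Y) = 0 /\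
  hurwitz (A - (1 - gamma ^- 2) *: (Y *m C^T *m C)).

Definition control_are_stabilizing (A : 'M[R]_n) (C : 'M[R]_(p, n))
    (W : 'M[R]_n) : Prop :=
  let B := g 0 in
  A^T *m W + W *m A + C^T *m C
    - (1 - gamma ^- 2) *: (W *m B *m B^T *m W) = 0 /\
  hurwitz (A - (1 - gamma ^- 2) *: (B *m B^T *m W)).

End Energies.

Section Transformation.
Variables (R : realType) (n : nat).

Definition posdef (A : 'M[R]_n) : Prop :=
  A^T = A /\ forall x : 'cV[R]_n, x != 0 -> 0 < (x^T *m A *m x) 0 0.

Definition orthogonal_mx (A : 'M[R]_n) : Prop := A^T *m A = 1%:M.

Definition is_svd (A U Xi V : 'M[R]_n) : Prop :=
  [/\ orthogonal_mx U, orthogonal_mx V, A = U *m Xi *m V^T &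
      is_diag_mx Xi /\ forall i, 0 <= Xi i i].

(* x = Phi z is analytic at the origin with Taylor coefficients T k, k >= 1
   (T 0 is never used), has nonsingular linear part, and is input-normal and
   output-diagonal for the pair (Em, Ep) with singular value functions xi.   *)
Definition iod_transformation (Em Ep : 'cV[R]_n -> R)
    (Phi : 'cV[R]_n -> 'cV[R]_n) (T : forall k, 'M[R]_(n, n ^ k))
    (xi : 'I_n -> R -> R) : Prop :=
  [/\ (T 1%N : 'M[R]_n) \in unitmx,
      \forall z \near (0 : 'cV[R]_n),
        series (fun k => T k.+1 *m kpow z k.+1) @ \oo --> Phi z,
      forall i, {for 0, continuous (xi i)} /\ 0 <= xi i 0,
      \forall z \near (0 : 'cV[R]_n), Em (Phi z) = 2^-1 * \sum_i z i 0 ^+ 2 &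
      \forall z \near (0 : 'cV[R]_n),
        Ep (Phi z) = 2^-1 * \sum_i xi i (z i 0) ^+ 2 * z i 0 ^+ 2].

(* The truncations of T 1 z + T 2 z^(2) + ... are input-normal for Em to every
   order: the degree K truncation matches all coefficients up to degree K + 1. *)
Definition input_normal_series (Em : 'cV[R]_n -> R)
    (T : forall k, 'M[R]_(n, n ^ k)) : Prop :=
  forall K : nat, exists C : R, \forall z \near (0 : 'cV[R]_n),
    `|Em (\sum_(1 <= k < K.+1) T k *m kpow z k) - 2^-1 * \sum_i z i 0 ^+ 2|
      <= C * `|z| ^+ K.+2.

(* The relations between the factorizations W2 = L L^T, V2 = Rf Rf^T,
   L^T Rf^-T = U Xi V^T and the linear part T1.                             *)
Definition linear_part (V2 W2 L Rf U Xi V T1 : 'M[R]_n) : Prop :=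
  [/\ T1 = invmx Rf^T *m V,
      T1 \in unitmx /\ invmx T1 = invmx Xi *m U^T *m L^T,
      T1^T *m V2 *m T1 = 1%:M,
      T1^T *m W2 *m T1 = Xi *m Xi &
      invmx T1 *m invmx V2 *m W2 *m T1 = Xi *m Xi].

End Transformation.

(* Main.v *)
Require Import Defs.
From HB Require Import structures.
From mathcomp Require Import all_boot all_order all_algebra perm.
From mathcomp Require Import mxtens complex.
From mathcomp Require Import all_classical all_reals all_analysis.
From mathcomp Require Import ring lra zify.

(* Along Phi, 2 Em is the sum over l of the homogeneous polynomials
   hcoef l z = sum_i v_i^T calT_{i,l} z^(l), the tuples (i_1, ..., i_m) of calT
   coming from the multilinear expansion of (sum_k T_k z^(k))^(m). If
   T_1^T V_2 T_1 = I, the compositions of k + 1 into two parts that contain a 1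
   contribute 2 z^T T_1^-1 T_k z^(k), and all the other compositions contribute
   z^T unvec(M_k)^T z^(k). Hence hcoef (k + 1) vanishes identically exactly when
   N = T_1^-1 T_k + unvec(M_k)^T / 2 satisfies z^T N z^(k) = 0 for all z.
   Since M_k only involves T_1, ..., T_{k-1}, N = 0 can be solved recursively.
   Conversely, for a given Phi, on each ray t z the function Em (Phi (t z))
   agrees with a polynomial in t up to O(t^(k+2)), which identifies its
   coefficients with those of t^2 |z|^2 / 2. *)

Set Implicit Arguments.
Unset Strict Implicit.
Unset Printing Implicit Defensive.
Import Order.TTheory GRing.Theory Num.Theory.
Import numFieldNormedType.Exports.
Local Open Scope classical_set_scope.
Local Open Scope ring_scope.

(** * Kronecker powers and dimension casts *)

Section CastTensor.
Variable R : realType.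

Lemma castmx_tensl (a b a' b' c e : nat) (ea : a = a') (eb : b = b')
    (A : 'M[R]_(a, b)) (B : 'M[R]_(c, e)) :
  castmx (ea, eb) A *t B =
  castmx (congr1 (muln^~ c) ea, congr1 (muln^~ e) eb) (A *t B).
Proof. by case: a' / ea; case: b' / eb; rewrite !castmx_id. Qed.

Lemma castmx_tensr (a b c e c' e' : nat) (ec : c = c') (ee : e = e')
    (A : 'M[R]_(a, b)) (B : 'M[R]_(c, e)) :
  A *t castmx (ec, ee) B = castmx (congr1 (muln a) ec, congr1 (muln b) ee) (A *t B).
Proof. by case: c' / ec; case: e' / ee; rewrite !castmx_id. Qed.

Lemma tensmxA (a b c e f g : nat) (A : 'M[R]_(a, b)) (B : 'M[R]_(c, e))
    (D : 'M[R]_(f, g)) :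
  A *t (B *t D) = castmx (esym (mulnA a c f), esym (mulnA b e g)) (A *t B *t D).
Proof.
apply: (canRL (castmxKV _ _)); apply/matrixP => i j.
case: (mxtens_indexP i) => i1 i2; case: (mxtens_indexP i1) => i11 i12 {i i1}.
case: (mxtens_indexP j) => j1 j2; case: (mxtens_indexP j1) => j11 j12 {j j1}.
rewrite castmxE !tensmxE.
have -> : cast_ord (esym (esym (esym (mulnA a c f))))
    (mxtens_index (mxtens_index (i11, i12), i2))
   = mxtens_index (i11, mxtens_index (i12, i2)).
  by apply: val_inj => /=; rewrite mulnDl mulnA addnA.
have -> : cast_ord (esym (esym (esym (mulnA b e g))))
    (mxtens_index (mxtens_index (j11, j12), j2))
   = mxtens_index (j11, mxtens_index (j12, j2)).
  by apply: val_inj => /=; rewrite mulnDl mulnA addnA.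
by rewrite !tensmxE mulrA.
Qed.

Lemma tensmx_suml (I : Type) (r : seq I) (P : pred I) (a b c e : nat)
    (F : I -> 'M[R]_(a, b)) (B : 'M[R]_(c, e)) :
  (\sum_(i <- r | P i) F i) *t B = \sum_(i <- r | P i) (F i *t B).
Proof.
apply/matrixP => i j; rewrite !mxE !summxE mulr_suml.
by apply: eq_bigr => k _; rewrite !mxE.
Qed.

Lemma tensmx_sumr (I : Type) (r : seq I) (P : pred I) (a b c e : nat)
    (B : 'M[R]_(c, e)) (F : I -> 'M[R]_(a, b)) :
  B *t (\sum_(i <- r | P i) F i) = \sum_(i <- r | P i) (B *t F i).
Proof.
apply/matrixP => i j; rewrite !mxE !summxE mulr_sumr.
by apply: eq_bigr => k _; rewrite !mxE.
Qed.

Lemma castmx_sum (I : Type) (r : seq I) (P : pred I) (a b a' b' : nat)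
    (e : (a = a') * (b = b')) (F : I -> 'M[R]_(a, b)) :
  castmx e (\sum_(i <- r | P i) F i) = \sum_(i <- r | P i) castmx e (F i).
Proof. by case: e => ea eb; case: a' / ea; case: b' / eb; rewrite castmx_id. Qed.

Lemma conform_castmx (a b a' b' : nat) (e : (a = a') * (b = b'))
    (B : 'M[R]_(a', b')) (A : 'M[R]_(a, b)) : conform_mx B A = castmx e A.
Proof.
case: e => ea eb; case: a' / ea B; case: b' / eb => B.
by rewrite conform_mx_id castmx_id.
Qed.

(** Column stacking makes the column index the leading one, so the vector paired with the columns is
    the first tensor factor. *)
Lemma vecE (a b : nat) (A : 'M[R]_(a, b)) (x : 'cV[R]_b) (y : 'cV[R]_a) :
  (vec A)^T *m (x *t y) = y^T *m A *m x.
Proof.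
apply/matrixP => i j; rewrite !ord1 {i j}.
rewrite [LHS]mxE (reindex (@mxtens_index b a)) /=; last first.
  by exists (@mxtens_unindex b a) => k _; rewrite (mxtens_indexK, mxtens_unindexK).
transitivity (\sum_i \sum_j (vec A)^T 0 (mxtens_index (i, j)) *
   (x *t y) (mxtens_index (i, j)) 0).
  by rewrite pair_bigA; apply: eq_bigr => -[].
rewrite mxE; apply: eq_bigr => i _; rewrite mxE mulr_suml.
apply: eq_bigr => j _; rewrite !mxE !mxtens_indexK /= !ord1.
by ring.
Qed.

Lemma unvecK (a b : nat) (v : 'cV[R]_(b * a)) : vec (@unvec R a b v) = v.
Proof.
apply/matrixP => i j; rewrite !mxE ord1.
by rewrite -surjective_pairing mxtens_unindexK.
Qed.

End CastTensor.

Section TensorPowers.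
Variables (R : realType) (n : nat).
Implicit Types (z : 'cV[R]_n) (T : forall k : nat, 'M[R]_(n, n ^ k)).

(** The summands of a multilinear expansion, indexed by lists so as to match [kronT]. *)
Fixpoint kprod (a : nat -> 'cV[R]_n) (s : seq nat) : 'cV[R]_(n ^ size s) :=
  match s with
  | [::] => const_mx 1
  | i :: s' => castmx (esym (expnS n (size s')), erefl 1%N) (a i *t kprod a s')
  end.

Lemma kpowS z k :
  kpow z k.+1 = castmx (esym (expnS n k), erefl 1%N) (z *t kpow z k).
Proof. by []. Qed.

Lemma kpowD z i j :
  kpow z (i + j) = castmx (esym (expnD n i j), erefl 1%N) (kpow z i *t kpow z j).
Proof.
elim: i => [|i IH].
  have -> : kpow z 0 = 1%:M by apply/matrixP => a b; rewrite !ord1 !mxE.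
  by rewrite tens_scalar_mx castmx_comp scale1r castmx_id.
transitivity (castmx (esym (expnS n (i + j)), erefl 1%N) (z *t kpow z (i + j))).
  by [].
rewrite IH kpowS castmx_tensr castmx_tensl.
rewrite (tensmxA z (kpow z i) (kpow z j)) !castmx_comp.
by congr (castmx (_, _) _); apply: nat_irrelevance.
Qed.

(** The mixed-product rule, once the Kronecker power of [z] is split along the parts of [s]. *)
Lemma kronT_kpow T z s :
  kronT T s *m kpow z (sumn s) = kprod (fun k => T k *m kpow z k) s.
Proof.
elim: s => [|i s IH] /=.
  by apply/matrixP => a b; rewrite !ord1 !mxE big_ord1 !mxE mulr1.
rewrite kpowD -IH -tensmx_mul.
by rewrite mulmx_cast castmx_comp castmx_mul; congr (castmx _ _ *m _);
   congr (_, _); apply: nat_irrelevance.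
Qed.

Lemma conform_kprod_cons a i s m : size s = m ->
  conform_mx 0 (kprod a (i :: s)) =
  castmx (esym (expnS n m), erefl 1%N)
    (a i *t conform_mx (0 : 'cV[R]_(n ^ m)) (kprod a s)).
Proof. by move=> <-; rewrite !conform_mx_id. Qed.

Lemma conform_kronT_kpow T z s m l : size s = m -> sumn s = l ->
  conform_mx 0 (kronT T s) *m kpow z l =
  conform_mx (0 : 'cV[R]_(n ^ m)) (kprod (fun k => T k *m kpow z k) s).
Proof. by move=> <- <-; rewrite !conform_mx_id kronT_kpow. Qed.

Lemma calT_kpow T z m l : calT T m l *m kpow z l =
  \sum_(t : m.-tuple 'I_l.+1 |
          all (fun i : 'I_l.+1 => (0 < i)%N) t
          && (sumn (map (@nat_of_ord l.+1) t) == l))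
     conform_mx (0 : 'cV[R]_(n ^ m))
       (kprod (fun k => T k *m kpow z k) (map (@nat_of_ord l.+1) t)).
Proof.
rewrite /calT mulmx_suml; apply: eq_bigr => t /andP[_ /eqP tl].
by apply: conform_kronT_kpow; rewrite // size_map size_tuple.
Qed.

Lemma big_tupleS (I : finType) (V : nmodType) m (Q : pred (m.+1.-tuple I))
    (F : m.+1.-tuple I -> V) :
  \sum_(t | Q t) F t =
  \sum_i \sum_(t : m.-tuple I | Q [tuple of i :: t]) F [tuple of i :: t].
Proof.
rewrite pair_big_dep.
rewrite (reindex (fun p : I * m.-tuple I => [tuple of p.1 :: p.2])) //=.
exists (fun t : m.+1.-tuple I => (thead t, [tuple of behead t])) => [[i t] _|t _] /=.
  by congr (_, _); apply: val_inj.
by rewrite [RHS]tuple_eta; apply: val_inj.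
Qed.

(** Multilinearity, one tensor factor at a time. With [P] the positivity of the index, the tuples
    are those of [calT] before the constraint on their sum. *)
Lemma kpow_sum (a : nat -> 'cV[R]_n) N (P : pred nat) m :
  kpow (\sum_(i < N | P i) a i) m =
  \sum_(t : m.-tuple 'I_N | all (fun i : 'I_N => P i) t)
     conform_mx (0 : 'cV[R]_(n ^ m)) (kprod a (map (@nat_of_ord N) t)).
Proof.
elim: m => [|m IH].
  rewrite (big_pred1 [tuple]) /=; first by rewrite conform_mx_id.
  by move=> t; rewrite (tuple0 t) /= eqxx.
rewrite kpowS IH big_tupleS tensmx_suml castmx_sum big_mkcond.
apply: eq_bigr => i _ /=; case: (P i); last by rewrite big_pred0.
rewrite tensmx_sumr castmx_sum; apply: eq_bigr => t _.
by rewrite /= conform_kprod_cons // size_map size_tuple.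
Qed.

End TensorPowers.

(** * Tensors determined by lower-degree ones *)

Section Locality.
Variables (R : realType) (n : nat).
Implicit Types (z : 'cV[R]_n) (T : forall k : nat, 'M[R]_(n, n ^ k)).
Implicit Types (v : forall i, 'cV[R]_(n ^ i)).

Lemma leq_size_sumn (s : seq nat) : all (leq 1) s -> (size s <= sumn s)%N.
Proof. by elim: s => //= i s IH /andP[i0 /IH]; rewrite -add1n; apply: leq_add. Qed.

(** The parts other than [j] number [size s - 1], and each is at least 1. *)
Lemma mem_addn_size (s : seq nat) j :
  all (leq 1) s -> j \in s -> (j + size s <= (sumn s).+1)%N.
Proof.
elim: s => //= i s IH /andP[i0 s0]; rewrite inE => /orP[/eqP ->|/(IH s0)].
  by have := leq_size_sumn s0; lia.
by lia.
Qed.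

Lemma sumn_bounded (s : seq nat) K : all (leq^~ K) s -> (sumn s <= size s * K)%N.
Proof.
by elim: s => //= i s IH /andP[iK /IH]; rewrite mulSn; apply: leq_add.
Qed.

Lemma eq_kronT T T' s : {in s, forall k, T k = T' k} -> kronT T s = kronT T' s.
Proof.
elim: s => //= i s IH H; rewrite H ?mem_head // IH // => k ks.
by apply: H; rewrite inE ks orbT.
Qed.

Lemma tuple_pos m N (t : m.-tuple 'I_N) :
  all (fun i : 'I_N => (0 < i)%N) t = all (leq 1) (map (@nat_of_ord N) t).
Proof. by rewrite all_map. Qed.

Lemma eq_calT T T' m l :
  (forall j, (0 < j)%N -> (j + m <= l.+1)%N -> T j = T' j) ->
  calT T m l = calT T' m l.
Proof.
move=> H; apply: eq_bigr => t /andP[]; rewrite tuple_pos => t0 /eqP tl.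
congr conform_mx; apply: eq_kronT => j jt; apply: H.
  by move/allP: t0; apply.
by have := mem_addn_size t0 jt; rewrite tl size_map size_tuple.
Qed.

Lemma calT_lt T m l : (l < m)%N -> calT T m l = 0.
Proof.
move=> lm; apply: big1 => t /andP[]; rewrite tuple_pos => /leq_size_sumn H /eqP tl.
by rewrite tl size_map size_tuple leqNgt lm in H.
Qed.

(** In the first sum of M_k both indices exceed 1 and add up to k + 1; in the second there are at
    least three parts. Either way every index is at most k - 1, which makes the formula for T_k a
    recursion. *)
Lemma eq_Mmx T T' v k :
  (forall j, (0 < j < k)%N -> T j = T' j) -> Mmx T v k = Mmx T' v k.
Proof.
move=> H; congr (unvec (castmx _ _)); congr (_ + _).
  apply: eq_bigr => i _; apply: eq_bigr => j /and3P[i1 j1 /eqP ij].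
  by rewrite !H //; lia.
rewrite !big_nat; apply: eq_bigr => i /andP[i3 ik].
by rewrite (@eq_calT T T') // => j j0 jk; apply: H; lia.
Qed.

(** Course-of-values recursion for families whose types depend on the index: [F] acts on whole
    families, as [Mmx] does, and its locality makes the recursion well founded. *)
Lemma exists_series (F : (forall k, 'M[R]_(n, n ^ k)) -> forall k, 'M[R]_(n, n ^ k)) :
  (forall T T' k, (forall j, (j < k)%N -> T j = T' j) -> F T k = F T' k) ->
  exists T, forall k, T k = F T k.
Proof.
(* Entry k of the iterates of F is constant from step k + 1 on. *)
move=> Floc; pose It i := iter i F (fun _ => 0).
have stable k i j : (k < i)%N -> (k < j)%N -> It i k = It j k.
  elim/ltn_ind: k i j => k IH [|i] [|j] //= ki kj.
  by apply: Floc => q qk; apply: IH; lia.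
exists (fun k => It k.+1 k) => k /=.
by apply: Floc => j jk; apply: (stable _ k j.+1); lia.
Qed.

End Locality.

(** * Homogeneous parts of the transformed energy *)

Section Expansion.
Variables (R : realType) (n : nat).
Implicit Types (z : 'cV[R]_n) (T : forall k : nat, 'M[R]_(n, n ^ k)).
Implicit Types (v : forall i, 'cV[R]_(n ^ i)).

(** The tuple type in [calT] depends on [l], and summing over [l] needs a common one. Parts of a
    composition of [l] never exceed [l], so a larger bound adds no tuples. *)
Lemma big_tuple_widen (V : nmodType) m l N (P : pred (seq nat)) (F : seq nat -> V) :
  (l <= N)%N ->
  \sum_(t : m.-tuple 'I_l.+1 | P (map (@nat_of_ord _) t)
     && (sumn (map (@nat_of_ord _) t) == l)) F (map (@nat_of_ord _) t) =
  \sum_(t : m.-tuple 'I_N.+1 | P (map (@nat_of_ord _) t)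
     && (sumn (map (@nat_of_ord _) t) == l)) F (map (@nat_of_ord _) t).
Proof.
move=> lN; have lN1 : (l.+1 <= N.+1)%N by [].
pose h (t : m.-tuple 'I_l.+1) := map_tuple (widen_ord lN1) t.
(* [inord] takes its default value only above [l], where no part lies when the sum is [l]. *)
pose h' (t : m.-tuple 'I_N.+1) : m.-tuple 'I_l.+1 :=
  map_tuple (fun i => inord (val i)) t.
have hE t : map (@nat_of_ord _) (h t) = map (@nat_of_ord _) t.
  by rewrite -map_comp; apply: eq_map.
rewrite [RHS](reindex_onto h h') /=.
  apply: eq_big => t; rewrite ?hE //.
  suff -> : h' (h t) == t by rewrite andbT.
  apply/eqP/val_inj; rewrite /= -map_comp -[RHS]map_id; apply: eq_map => i /=.
  by rewrite inord_val.
move=> t /andP[_ /eqP tl]; apply/val_inj; rewrite /= -map_comp -[RHS]map_id.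
apply/eq_in_map => i it /=; apply: val_inj => /=; rewrite inordK // ltnS -tl.
have : val i \in map (@nat_of_ord _) t by apply: map_f.
move: (map _ _); elim=> //= j s IH; rewrite inE => /orP[/eqP -> |/IH]; lia.
Qed.

Lemma kprod0 (a : nat -> 'cV[R]_n) s j : j \in s -> a j = 0 -> kprod a s = 0.
Proof.
elim: s => //= i s IH; rewrite inE => /orP[/eqP <- -> |/IH + aj].
  by rewrite tens0mx castmx_const.
by move=> ->//; rewrite tensmx0 castmx_const.
Qed.

Lemma conform_mx0 a b a' b' : conform_mx (0 : 'M[R]_(a, b)) (0 : 'M[R]_(a', b')) = 0.
Proof.
rewrite /conform_mx; case: eqP => // e1; case: eqP => // e2.
by rewrite castmx_const.
Qed.

(** The tuples of the multilinear expansion are grouped by their sum [l]. Those with sum above [N]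
    are missing on the right, but as [m * K <= N] they have a part above [K], where the tensor is
    zero. *)
Lemma kpow_truncated_series T z K N m :
  (forall k, (K < k)%N -> T k = 0) -> (m * K <= N)%N -> (K <= N)%N ->
  kpow (\sum_(1 <= k < K.+1) T k *m kpow z k) m =
  \sum_(l < N.+1) calT T m l *m kpow z l.
Proof.
move=> TK mKN KN; set a := fun k => T k *m kpow z k.
have -> : \sum_(1 <= k < K.+1) a k = \sum_(k < N.+1 | (0 < k)%N) a k.
  rewrite (big_nat_widen _ _ N.+1) // (big_nat_widenl _ 0) //= [RHS]big_mkcond /=.
  rewrite -(big_mkord xpredT (fun k => if (0 < k)%N then a k else 0)) big_mkcond.
  apply: eq_bigr => k _; case: ifP; rewrite ?andbT.
    by case: (0 < k)%N; rewrite ?andbF.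
  by case: ifP => // k0; rewrite andbT => kK; rewrite /a TK ?mul0mx//; lia.
rewrite kpow_sum.
under [RHS]eq_bigr => l _.
  rewrite calT_kpow.
  under eq_bigl => t do rewrite tuple_pos.
  rewrite (@big_tuple_widen _ m l N (all (leq 1))
    (fun s => conform_mx (0 : 'cV[R]_(n ^ m)) (kprod _ s))); last first.
    by rewrite -ltnS.
  over.
rewrite (exchange_big_dep (fun t : m.-tuple 'I_N.+1 =>
  all (fun i : 'I_N.+1 => (0 < i)%N) t)) /=; last first.
  by move=> i t _ /andP[]; rewrite tuple_pos.
apply: eq_bigr => t t0; set s := map _ _; set x := conform_mx _ _.
have [sN|Ns] := ltnP (sumn s) N.+1.
  rewrite (big_pred1 (Ordinal sN)) // => l.
  by rewrite -tuple_pos t0 /= -val_eqE /= eq_sym.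
suff -> : x = 0 by rewrite big1.
have : ~~ all (leq^~ K) s.
  apply/negP => /sumn_bounded; rewrite size_map size_tuple; lia.
move=> /allPn[j js jK]; rewrite /x (kprod0 js) ?conform_mx0 //.
by rewrite /a /= TK ?mul0mx // ltnNge.
Qed.

Definition hcoef T v d l z : R :=
  \sum_(2 <= i < d.+1) ((v i)^T *m (calT T i l *m kpow z l)) 0 0.

Lemma poly_energy_truncated_series T v z d K :
  (forall k, (K < k)%N -> T k = 0) ->
  poly_energy d v (\sum_(1 <= k < K.+1) T k *m kpow z k) =
  2^-1 * \sum_(l < (d * K).+1) hcoef T v d l z.
Proof.
move=> TK; congr (_ * _); rewrite /hcoef [RHS]exchange_big /= big_nat [RHS]big_nat.
apply: eq_bigr => i /andP[i2 id].
rewrite (@kpow_truncated_series T z K (d * K)) //; first last.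
- by rewrite leq_pmull //; lia.
- by rewrite leq_mul2r -ltnS id orbT.
by rewrite mulmx_sumr summxE.
Qed.

Lemma hcoef_lt2 T v d l z : (l < 2)%N -> hcoef T v d l z = 0.
Proof.
move=> l2; rewrite /hcoef big_nat big1 // => i /andP[i2 _].
by rewrite calT_lt ?mul0mx ?mulmx0 ?mxE //; lia.
Qed.

(** At least two factors are present, so no part of a composition of [l] exceeds [l - 1]. Hence
    truncating at degree K preserves the coefficients up to degree K + 1. *)
Lemma eq_hcoef T T' v d l z :
  (forall j, (0 < j < l)%N -> T j = T' j) -> hcoef T v d l z = hcoef T' v d l z.
Proof.
move=> H; rewrite /hcoef !big_nat; apply: eq_bigr => i /andP[i2 _].
by rewrite (@eq_calT _ _ T T') // => j j0 jl; apply: H; lia.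
Qed.

(** Terms beyond [d] vanish with [v i], terms beyond [l] with [calT]; the two ranges are compared
    inside the common range up to [d + l]. *)
Lemma hcoef_deg T v d l z : (forall i, (d < i)%N -> v i = 0) ->
  hcoef T v d l z =
  \sum_(2 <= i < l.+1) ((v i)^T *m (calT T i l *m kpow z l)) 0 0.
Proof.
move=> vd; rewrite /hcoef.
pose F i := ((v i)^T *m (calT T i l *m kpow z l)) 0 0.
rewrite (big_nat_widen _ _ (d + l).+1) ?ltnS ?leq_addr //.
rewrite [RHS](big_nat_widen _ _ (d + l).+1) ?ltnS ?leq_addl //.
rewrite [LHS]big_mkcond [RHS]big_mkcond; apply: eq_bigr => i _ /=.
have Fd : ~~ (i < d.+1)%N -> F i = 0.
  by move=> di; rewrite /F vd ?trmx0 ?mul0mx ?mxE //; lia.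
have Fl : ~~ (i < l.+1)%N -> F i = 0.
  by move=> li; rewrite /F calT_lt ?mul0mx ?mulmx0 ?mxE //; lia.
rewrite -/(F i); case: ifP => [_|/negbT/Fd ->]; case: ifP => //.
by move=> /negbT/Fl.
Qed.

Lemma kprod_pair (a : nat -> 'cV[R]_n) i j :
  (kprod a [:: i; j] : 'cV[R]_(n * n)) = a i *t a j.
Proof.
rewrite /=; have -> : const_mx 1 = 1%:M :> 'cV[R]_1.
  by apply/matrixP => x y; rewrite !ord1 !mxE.
rewrite tens_mx_scalar scale1r castmx_comp castmx_tensr castmx_comp castmx_id.
by [].
Qed.

Lemma quad_form v (x y : 'cV[R]_n) :
  ((v 2%N : 'cV[R]_(n * n))^T *m (x *t y)) = y^T *m quad_mx v *m x.
Proof. by rewrite -vecE unvecK. Qed.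

Lemma big_tuple0 (I : finType) (V : nmodType) (Q : pred (0.-tuple I))
    (F : 0.-tuple I -> V) :
  \sum_(t | Q t) F t = if Q [tuple] then F [tuple] else 0.
Proof.
rewrite big_mkcond (big_pred1 [tuple]) // => t.
by rewrite (tuple0 t) /= eqxx.
Qed.

Lemma calT2_kpow T v z l :
  ((v 2%N)^T *m (calT T 2 l *m kpow z l)) 0 0 =
  \sum_(i < l.+1) \sum_(j < l.+1 | [&& (0 < i)%N, (0 < j)%N & (i + j == l)%N])
     ((T j *m kpow z j)^T *m quad_mx v *m (T i *m kpow z i)) 0 0.
Proof.
rewrite calT_kpow big_tupleS mulmx_sumr summxE; apply: eq_bigr => i _.
rewrite big_tupleS mulmx_sumr summxE [RHS]big_mkcond; apply: eq_bigr => j _.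
rewrite big_tuple0 /= !andbT addn0 -andbA.
case: ifP => _; last by rewrite mulmx0 mxE.
rewrite -quad_form -(kprod_pair (fun k => T k *m kpow z k)).
by rewrite conform_mx_id.
Qed.

Lemma kpow1 z : (kpow z 1 : 'cV[R]_n) = z.
Proof.
rewrite /kpow /=; have -> : const_mx 1 = 1%:M :> 'cV[R]_1.
  by apply/matrixP => x y; rewrite !ord1 !mxE.
by rewrite tens_mx_scalar scale1r !castmx_comp castmx_id.
Qed.

Lemma T1_kpow1 T z : T 1%N *m kpow z 1 = (T 1%N : 'M[R]_n) *m z.
Proof. by rewrite -{2}(kpow1 z). Qed.

Lemma conform_kpowD i j l (X : 'cV[R]_(n ^ i * n ^ j)) z : (i + j = l)%N ->
  (conform_mx (0 : 'cV[R]_(n ^ l)) X)^T *m kpow z l = X^T *m (kpow z i *t kpow z j).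
Proof.
move=> <-; rewrite (conform_castmx (esym (expnD n i j), erefl 1%N)) kpowD.
by rewrite trmx_cast mulmx_cast !castmx_comp !castmx_id.
Qed.

Lemma Mmx_form T v z k :
  z^T *m (Mmx T v k)^T *m kpow z k = (Mvec T v k)^T *m kpow z k.+1.
Proof.
have tr11 (X : 'M[R]_1) : X^T = X by apply/matrixP => i j; rewrite !ord1 mxE.
rewrite -[LHS]tr11 !trmx_mul !trmxK mulmxA -vecE unvecK.
by rewrite kpowS mulmx_cast trmx_cast /= !castmx_id esymK.
Qed.

(** The compositions (1, k) and (k, 1) give equal terms by symmetry of V_2, whence the factor 2. The
    other compositions into two parts and those into at least three are the two sums of M_k. *)
Lemma degree_part T v z k : (2 <= k)%N -> (quad_mx v)^T = quad_mx v ->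
  \sum_(2 <= i < k.+2) ((v i)^T *m (calT T i k.+1 *m kpow z k.+1)) 0 0 =
  2 * (z^T *m (T 1%N : 'M[R]_n)^T *m quad_mx v *m T k *m kpow z k) 0 0
  + (z^T *m (Mmx T v k)^T *m kpow z k) 0 0.
Proof.
move=> k2 Vs; have k3 : (2 < k.+2)%N by lia.
rewrite (big_ltn k3) calT2_kpow Mmx_form /Mvec.
pose G i j : R := ((T j *m kpow z j)^T *m quad_mx v *m (T i *m kpow z i)) 0 0.
have Gs i j : G i j = G j i.
  have tr00 (X : 'M[R]_1) : X 0 0 = X^T 0 0 by rewrite mxE.
  by rewrite /G [LHS]tr00 trmx_mul [(_^T *m quad_mx v)^T]trmx_mul trmxK Vs mulmxA.
rewrite [(_ + _)^T]linearD /= mulmxDl.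
have addE (X Y : 'M[R]_1) : (X + Y) 0 0 = X 0 0 + Y 0 0 by rewrite mxE.
rewrite addE addrA; congr (_ + _); last first.
  rewrite linear_sum mulmx_suml summxE; apply: eq_bigr => i _ /=.
  by rewrite trmx_mul trmxK mulmxA.
have -> : z^T *m (T 1%N : 'M[R]_n)^T *m quad_mx v *m T k *m kpow z k =
   (T 1%N *m kpow z 1)^T *m quad_mx v *m (T k *m kpow z k).
  by rewrite T1_kpow1 trmx_mul !mulmxA.
have -> : ((T 1%N *m kpow z 1)^T *m quad_mx v *m (T k *m kpow z k)) 0 0 = G k 1%N by [].
have -> : ((\sum_(i < k.+2)
       \sum_(j < k.+2 | [&& (1 < i)%N, (1 < j)%N & (i + j == k.+1)%N])
     conform_mx (0 : 'cV[R]_(n ^ k.+1))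
       (vec ((T j)^T *m quad_mx v *m T i)))^T *m kpow z k.+1) 0 0
   = \sum_(i < k.+2)
       \sum_(j < k.+2 | [&& (1 < i)%N, (1 < j)%N & (i + j == k.+1)%N]) G i j.
  rewrite linear_sum mulmx_suml summxE; apply: eq_bigr => i _ /=.
  rewrite linear_sum mulmx_suml summxE; apply: eq_bigr => j /and3P[_ _ /eqP ij] /=.
  by rewrite conform_kpowD // vecE /G trmx_mul !mulmxA.
rewrite -[LHS]/(\sum_(i < k.+2) \sum_(j < k.+2 |
  [&& (0 < i)%N, (0 < j)%N & (i + j == k.+1)%N]) G i j) !pair_big_dep /=.
have l1 : (1 < k.+2)%N by [].
have lk : (k < k.+2)%N by [].
(* The two pairs are distinct because k >= 2, so both can be split off. *)
pose p1 := (Ordinal l1, Ordinal lk); pose p2 := (Ordinal lk, Ordinal l1).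
rewrite (bigD1 p1) /=; last by rewrite add1n eqxx; lia.
rewrite (bigD1 p2) /=; last by rewrite addn1 eqxx /p1 /p2 xpair_eqE -!val_eqE /=; lia.
rewrite (Gs 1%N k) addrA -mulr2n; congr (_ + _).
  by rewrite mulr_natl.
apply: eq_bigl => -[i j]; rewrite /p1 /p2 !xpair_eqE -!val_eqE /=.
by have := ltn_ord i; have := ltn_ord j; lia.
Qed.

End Expansion.

(** * The linear part *)

Section LinearPart.
Variables (R : realType) (n : nat).
Implicit Types A B : 'M[R]_n.

Lemma posdef_unit A : posdef A -> A \in unitmx.
Proof.
case=> As Ap; rewrite unitmxE unitfE; apply/det0P => -[x x0 xA].
have := Ap x^T; rewrite trmx_eq0 trmxK xA mul0mx mxE ltxx.
by move=> /(_ x0).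
Qed.

(** Polarization: at e_i + e_j the form is the sum of its values at e_i and e_j plus twice the entry
    (i, j). *)
Lemma sym_form_inj A B : A^T = A -> B^T = B ->
  (forall z : 'cV[R]_n, (z^T *m A *m z) 0 0 = (z^T *m B *m z) 0 0) -> A = B.
Proof.
move=> As Bs H.
have tr00 (X : 'M[R]_1) : X 0 0 = X^T 0 0 by rewrite mxE.
have addE (X Y : 'M[R]_1) : (X + Y) 0 0 = X 0 0 + Y 0 0 by rewrite mxE.
have polar (M : 'M[R]_n) (x y : 'cV[R]_n) : M^T = M ->
    ((x + y)^T *m M *m (x + y)) 0 0 =
    (x^T *m M *m x) 0 0 + (y^T *m M *m y) 0 0 + 2 * (x^T *m M *m y) 0 0.
  move=> Ms; rewrite [(x + y)^T]linearD /= !mulmxDl !mulmxDr !addE.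
  have -> : (y^T *m M *m x) 0 0 = (x^T *m M *m y) 0 0.
    by rewrite tr00 trmx_mul [(y^T *m M)^T]trmx_mul trmxK Ms mulmxA.
  by ring.
have formE (M : 'M[R]_n) i j :
    ((delta_mx i 0 : 'cV[R]_n)^T *m M *m (delta_mx j 0 : 'cV[R]_n)) 0 0 = M i j.
  by rewrite trmx_delta -rowE -colE !mxE.
apply/matrixP => i j; rewrite -formE -[RHS]formE.
have := H (delta_mx i 0 + delta_mx j 0); rewrite !polar // !H => /addrI.
by apply: mulfI; rewrite pnatr_eq0.
Qed.

Lemma tr_is_diag_mx A : is_diag_mx A -> A^T = A.
Proof.
move=> /is_diag_mxP Ad; apply/matrixP => i j; rewrite mxE.
have [->//|ij] := eqVneq i j.
by rewrite !Ad // eq_sym.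
Qed.

(** Everything follows from L^T T_1 = U Xi and T_1^T V_2 T_1 = I. The first gives the inverse and
    the output-diagonal form; the second gives T_1^-1 V_2^-1 = T_1^T and with it the similarity.
    [Xi] is invertible because [L] and [Rf] are. *)
Lemma svd_linear_part (V2 W2 L Rf U Xi V : 'M[R]_n) :
  posdef V2 -> posdef W2 -> W2 = L *m L^T -> V2 = Rf *m Rf^T ->
  is_svd (L^T *m invmx Rf^T) U Xi V ->
  linear_part V2 W2 L Rf U Xi V (invmx Rf^T *m V).
Proof.
move=> /posdef_unit V2u /posdef_unit W2u WE VE [Uo Vo svdE [Xd Xp]].
have Ru : Rf \in unitmx by move: V2u; rewrite VE unitmx_mul => /andP[].
have Lu : L \in unitmx by move: W2u; rewrite WE unitmx_mul => /andP[].
have RTu : Rf^T \in unitmx by rewrite unitmx_tr.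
have Vu : V \in unitmx by case/mulmx1_unit: Vo.
have XVu : U *m Xi *m V^T \in unitmx.
  by rewrite -svdE unitmx_mul unitmx_inv RTu unitmx_tr Lu.
have Xu : Xi \in unitmx.
  by move: XVu; rewrite !unitmx_mul -andbA => /and3P[].
have Tu : invmx Rf^T *m V \in unitmx by rewrite unitmx_mul unitmx_inv RTu Vu.
have RiT : (invmx Rf^T)^T = invmx Rf by rewrite trmx_inv trmxK.
have LR : L^T = U *m Xi *m V^T *m Rf^T by rewrite -svdE mulmxKV.
have TL : L^T *m (invmx Rf^T *m V) = U *m Xi.
  by rewrite mulmxA svdE -mulmxA Vo mulmx1.
have inV : (invmx Rf^T *m V)^T *m V2 *m (invmx Rf^T *m V) = 1%:M.
  rewrite trmx_mul RiT VE !mulmxA -(mulmxA V^T) mulVmx // mulmx1.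
  by rewrite -(mulmxA V^T) mulmxV // mulmx1.
have outW : (invmx Rf^T *m V)^T *m W2 *m (invmx Rf^T *m V) = Xi *m Xi.
  rewrite WE -!mulmxA TL mulmxA -{1}[L]trmxK -trmx_mul TL trmx_mul.
  by rewrite (tr_is_diag_mx Xd) -mulmxA (mulmxA U^T) Uo mul1mx.
have invT (Y : 'M[R]_n) : Y *m (invmx Rf^T *m V) = 1%:M -> invmx (invmx Rf^T *m V) = Y.
  by move=> YT; rewrite -[LHS]mul1mx -YT mulmxK.
split=> //.
  split=> //; apply: invT.
  by rewrite -!mulmxA TL (mulmxA U^T) Uo mul1mx mulVmx.
by rewrite (invT _ inV) mulmxK.
Qed.

(** A converse of [svd_linear_part]: T_1 = R^-T V forces V = R^T T_1, and the decomposition then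
    forces U = L^T T_1 Xi^-1. Input-normality makes V orthogonal, output-diagonality U. *)
Lemma linear_part_svd (V2 W2 L Rf Xi T1 : 'M[R]_n) :
  posdef V2 -> posdef W2 -> W2 = L *m L^T -> V2 = Rf *m Rf^T ->
  is_diag_mx Xi -> (forall i, 0 <= Xi i i) ->
  T1 \in unitmx -> T1^T *m V2 *m T1 = 1%:M -> T1^T *m W2 *m T1 = Xi *m Xi ->
  exists U V : 'M[R]_n, is_svd (L^T *m invmx Rf^T) U Xi V /\
    T1 = invmx Rf^T *m V.
Proof.
move=> /posdef_unit V2u /posdef_unit W2u WE VE Xd Xp Tu inV outW.
have Ru : Rf \in unitmx by move: V2u; rewrite VE unitmx_mul => /andP[].
have RTu : Rf^T \in unitmx by rewrite unitmx_tr.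
have Xu : Xi \in unitmx.
  have : Xi *m Xi \in unitmx by rewrite -outW !unitmx_mul unitmx_tr Tu W2u.
  by rewrite unitmx_mul => /andP[].
exists (L^T *m T1 *m invmx Xi), (Rf^T *m T1); split; last by rewrite mulKmx.
split=> //.
- rewrite /orthogonal_mx !trmx_mul trmxK trmx_inv (tr_is_diag_mx Xd) -!mulmxA.
  rewrite (mulmxA L) -WE (mulmxA W2) (mulmxA T1^T) (mulmxA T1^T W2) outW.
  by rewrite -mulmxA mulmxV // mulmx1 mulVmx.
- by rewrite /orthogonal_mx trmx_mul trmxK -!mulmxA (mulmxA Rf) -VE mulmxA.
rewrite mulmxKV // trmx_mul trmxK.
have : (Rf^T *m T1)^T *m (Rf^T *m T1) = 1%:M.
  by rewrite trmx_mul trmxK -!mulmxA (mulmxA Rf) -VE mulmxA.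
(* A left inverse of a square matrix is a right inverse, which gives R^-T = T_1 T_1^T R. *)
move=> /mulmx1C; rewrite trmx_mul trmxK => H.
rewrite -mulmxA; congr (_ *m _).
by rewrite -[LHS]mulmx1 -H -!mulmxA mulKmx.
Qed.

End LinearPart.

(** * Bounds *)

Section Norms.
Variable R : realType.

Lemma norm_entry (a b : nat) (A : 'M[R]_(a, b)) i j : `|A i j| <= `|A|.
Proof.
rewrite [leRHS]mx_normrE.
exact: (le_bigmax 0 (fun ij : 'I_a * 'I_b => `|A ij.1 ij.2|) (i, j)).
Qed.

Lemma norm_mx_le (a b : nat) (A : 'M[R]_(a, b)) r :
  0 <= r -> (forall i j, `|A i j| <= r) -> `|A| <= r.
Proof. by move=> r0 Ar; rewrite [leLHS]mx_normrE bigmax_le. Qed.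

Lemma norm_tensv (a b : nat) (x : 'cV[R]_a) (y : 'cV[R]_b) :
  `|x *t y : 'cV[R]_(a * b)| <= `|x| * `|y|.
Proof.
apply: norm_mx_le => [|i j]; first by rewrite mulr_ge0.
by rewrite mxE normrM ler_pM ?norm_entry.
Qed.

Lemma norm_castmx (a b a' b' : nat) (e : (a = a') * (b = b')) (A : 'M[R]_(a, b)) :
  `|castmx e A| = `|A|.
Proof. by case: e => ea eb; case: a' / ea; case: b' / eb; rewrite castmx_id. Qed.

Lemma norm_mulmx (a b c : nat) (A : 'M[R]_(a, b)) (B : 'M[R]_(b, c)) :
  `|A *m B| <= b%:R * `|A| * `|B|.
Proof.
apply: norm_mx_le => [|i j]; first by rewrite !mulr_ge0.
rewrite mxE (le_trans (ler_norm_sum _ _ _)) //.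
have -> : b%:R * `|A| * `|B| = \sum_(k < b) `|A| * `|B|.
  by rewrite sumr_const card_ord -mulrA mulr_natl.
by apply: ler_sum => k _; rewrite normrM ler_pM ?norm_entry.
Qed.

End Norms.

Section KroneckerNorms.
Variables (R : realType) (n : nat).
Implicit Types x y z : 'cV[R]_n.

Lemma kpowZ (t : R) z k : kpow (t *: z) k = t ^+ k *: kpow z k.
Proof.
elim: k => [|k IH]; first by rewrite expr0 scale1r.
rewrite !kpowS IH; apply/matrixP => i j.
by rewrite !(mxE, castmxE) exprS; ring.
Qed.

Lemma norm_kpow x r k : `|x| <= r -> `|kpow x k| <= r ^+ k.
Proof.
move=> xr; elim: k => [|k IH].
  by rewrite expr0 norm_mx_le // => i j; rewrite mxE normr1.
rewrite kpowS norm_castmx exprS (le_trans (norm_tensv _ _)) //.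
by rewrite ler_pM.
Qed.

(** Telescoping: the difference of the powers of order k + 1 is (x - y) tensor x^(k) plus y tensor
    (x^(k) - y^(k)). *)
Lemma norm_kpowB x y r k : `|x| <= r -> `|y| <= r ->
  `|kpow x k - kpow y k| <= k%:R * `|x - y| * r ^+ k.-1.
Proof.
move=> xr yr; have r0 : 0 <= r := le_trans (normr_ge0 _) xr.
elim: k => [|k IH]; first by rewrite subrr normr0 mul0r mul0r.
have -> : kpow x k.+1 - kpow y k.+1 = castmx (esym (expnS n k), erefl 1%N)
    ((x - y) *t kpow x k + y *t (kpow x k - kpow y k)).
  by rewrite !kpowS; apply/matrixP => i j; rewrite !(mxE, castmxE) /=; ring.
rewrite norm_castmx (le_trans (ler_normD _ _)) //= -natr1 !mulrDl mul1r addrC.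
apply: lerD; rewrite (le_trans (norm_tensv _ _)) //.
  apply: le_trans (_ : r * (k%:R * `|x - y| * r ^+ k.-1) <= _).
    by rewrite ler_pM.
  (* For k = 0 the truncated predecessor is harmless, its power being multiplied by zero. *)
  case: k {IH} => [|k /=]; first by rewrite !mul0r mulr0.
  by rewrite mulrCA exprS.
by rewrite ler_pM // norm_kpow.
Qed.

(** The energy starts in degree 2, so its Lipschitz constant on a ball of radius r <= 1 is O(r).
    This factor gains one order over the truncation error of Phi. *)
Lemma poly_energy_lipschitz d (v : forall i, 'cV[R]_(n ^ i)) :
  exists2 C, 0 <= C & forall r x y, r <= 1 -> `|x| <= r -> `|y| <= r ->
    `|poly_energy d v x - poly_energy d v y| <= C * `|x - y| * r.
Proof.
exists (\sum_(2 <= i < d.+1) (n ^ i)%:R * `|(v i)^T| * i%:R).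
  by apply: sumr_ge0 => i _; rewrite !mulr_ge0.
move=> r x y r1 xr yr; have r0 : 0 <= r := le_trans (normr_ge0 _) xr.
rewrite /poly_energy -mulrBr -sumrB normrM.
apply: (@le_trans _ _ (1 * `|\sum_(2 <= i < d.+1)
   (((v i)^T *m kpow x i) 0 0 - ((v i)^T *m kpow y i) 0 0)|)).
  by rewrite ler_pM // ger0_norm ?invf_le1 ?invr_ge0 ?ler1n.
rewrite mul1r -mulrA mulr_suml (le_trans (ler_norm_sum _ _ _)) //.
rewrite big_nat [leRHS]big_nat; apply: ler_sum => i /andP[i2 _].
have -> : ((v i)^T *m kpow x i) 0 0 - ((v i)^T *m kpow y i) 0 0 =
   ((v i)^T *m (kpow x i - kpow y i)) 0 0 by rewrite mulmxBr !mxE.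
rewrite (le_trans (norm_entry _ _ _)) // (le_trans (norm_mulmx _ _)) //.
rewrite -!mulrA ler_wpM2l // ler_wpM2l //.
rewrite (le_trans (norm_kpowB _ xr yr)) // -mulrA ler_wpM2l // ler_wpM2l //.
by case: i i2 => [|[|i]] // _; rewrite exprS ler_piMr // exprn_ile1.
Qed.

Lemma hcoefZ (T : forall k : nat, 'M[R]_(n, n ^ k)) v d l (t : R) z :
  hcoef T v d l (t *: z) = t ^+ l * hcoef T v d l z.
Proof.
rewrite /hcoef mulr_sumr; apply: eq_bigr => i _.
by rewrite kpowZ -!scalemxAr mxE.
Qed.

Lemma hcoef_bound (T : forall k : nat, 'M[R]_(n, n ^ k)) v d l :
  exists2 C, 0 <= C & forall z, `|hcoef T v d l z| <= C * `|z| ^+ l.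
Proof.
exists (\sum_(2 <= i < d.+1) (n ^ l)%:R * `|(v i)^T *m calT T i l|).
  by apply: sumr_ge0 => i _; rewrite mulr_ge0.
move=> z; rewrite mulr_suml (le_trans (ler_norm_sum _ _ _)) //.
apply: ler_sum => i _; rewrite mulmxA.
rewrite (le_trans (norm_entry _ _ _)) // (le_trans (norm_mulmx _ _)) //.
by rewrite ler_wpM2l ?mulr_ge0 // norm_kpow.
Qed.

End KroneckerNorms.

(** * Expansion along rays *)

Section Rays.
Variable R : realType.

Lemma cvg_dnbhs (T U : topologicalType) (f : T -> U) (x : T) (l : U) :
  f y @[y --> x] --> l -> f y @[y --> x^'] --> l.
Proof. by apply: cvg_trans; apply: cvg_app; exact: cvg_within. Qed.

Lemma near_norm_le (r : R) : 0 < r -> \forall t \near (0 : R), `|t| <= r.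
Proof.
move=> r0; apply/nbhs_ballP; exists r => // t.
by rewrite /ball /= sub0r normrN => /ltW.
Qed.

(** Letting t tend to 0 gives p(0) = 0. Dividing the bound by |t| away from 0 then passes to p / X
    with the exponent lowered by one. *)
Lemma poly_flat_coef (p : {poly R}) (N : nat) (C : R) :
  (\forall t \near (0 : R)^', `|p.[t]| <= C * `|t| ^+ N) ->
  forall l, (l < N)%N -> p`_l = 0.
Proof.
elim: N p => // N IH p pC.
have p0 : p.[0] = 0.
  have cp (q : {poly R}) : q.[t] @[t --> (0 : R)^'] --> (q.[0] : R).
    by apply: (@cvg_dnbhs R R); exact: continuous_horner.
  have C0 : (C *: 'X^(N.+1) : {poly R}).[`|0 : R|] = 0.
    by rewrite hornerZ hornerXn normr0 expr0n mulr0.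
  apply/eqP; rewrite -normr_le0 -[X in _ <= X]C0.
  apply: (@ler_cvg_to _ ((0 : R)^') _ _ (fun t => `|p.[t]|)
            (fun t => (C *: 'X^(N.+1)).[`|t|])).
  - by apply: cvg_norm; apply: cp.
  - apply: (@cvg_dnbhs R R).
    apply: (@cvg_comp _ _ _ (fun t : R => `|t|) (horner (C *: 'X^(N.+1)))).
      apply: cvg_norm; exact: cvg_id.
    exact: continuous_horner.
  - by apply: filterS pC => t; rewrite hornerZ hornerXn.
have /factor_theorem[q pq] : root p 0 by apply/rootP.
move: pq; rewrite subr0 => pq.
have qC : \forall t \near (0 : R)^', `|q.[t]| <= C * `|t| ^+ N.
  near=> t; have t0 : t != 0 by near: t; exact: nbhs_dnbhs_neq.
  rewrite -(@ler_pM2r _ `|t|) ?normr_gt0 // -mulrA -exprSr -normrM.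
  have -> : q.[t] * t = p.[t] by rewrite pq hornerMX.
  by near: t.
case=> [|l] lN; first by rewrite -horner_coef0.
by rewrite pq coefMX /= (IH _ qC).
Unshelve. all: by end_near.
Qed.

Lemma geometric_tail (r : R) (K N : nat) : 0 <= r -> r <= 2^-1 -> (K <= N)%N ->
  \sum_(K <= k < N) r ^+ k.+1 <= 2 * r ^+ K.+1.
Proof.
move=> r0 r2 KN.
(* The subtracted term makes the induction go through; its step uses 2 r <= 1. *)
suff : \sum_(K <= k < N) r ^+ k.+1 <= 2 * r ^+ K.+1 - 2 * r ^+ N.+1.
  by move/le_trans; apply; rewrite lerBlDr lerDl mulr_ge0 ?exprn_ge0.
rewrite -(subnKC KN); elim: (N - K)%N => [|m IH].
  by rewrite addn0 big_geq // subrr.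
rewrite addnS big_nat_recr ?leq_addr //= (exprS r (K + m).+1).
move: IH (exprn_ge0 (K + m).+1 r0).
move: (\sum_(_ <= _ < _) _) (r ^+ (K + m).+1) => S q IH q0.
suff : 2 * (r * q) <= q by lra.
by rewrite mulrA ler_piMl // mulrC -ler_pdivlMr // div1r.
Qed.

(** Convergence at the single point e / 2 bounds the terms there. For |t| <= e / 4 the tail is then
    dominated by a geometric series of ratio at most 1/2. *)
Lemma power_series_remainder n (b : nat -> 'cV[R]_n) (psi : R -> 'cV[R]_n) :
  (\forall t \near (0 : R),
     series (fun k => t ^+ k.+1 *: b k.+1) @ \oo --> psi t) ->
  forall K, exists2 C, 0 <= C &
    \forall t \near (0 : R),
      `|psi t - \sum_(1 <= k < K.+1) t ^+ k *: b k| <= C * `|t| ^+ K.+1.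
Proof.
move=> /nbhs_ballP[e /= e0 He] K.
have e20 : 0 < e / 2 by rewrite divr_gt0.
have cv t : `|t| < e -> series (fun k => t ^+ k.+1 *: b k.+1) @ \oo --> psi t.
  by move=> te; apply: He; rewrite /ball /= sub0r normrN.
have [M M0 HM] : exists2 M, 0 <= M & forall k, (e / 2) ^+ k.+1 * `|b k.+1| <= M.
  have /cvgP/cvg_series_cvg_0/cvgP/cvg_seq_bounded :
      series (fun k => (e / 2) ^+ k.+1 *: b k.+1) @ \oo --> psi (e / 2).
    by apply: cv; rewrite gtr0_norm // ltr_pdivrMr // ltr_pMr // ltr1n.
  move=> /pinfty_ex_gt0[M M0 HM]; exists M; first exact: ltW.
  move=> k; have /= := HM k Logic.I; rewrite normrZ normrX.
  by rewrite (gtr0_norm e20).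
(* [M] bounds the terms at e / 2, and 2 r^(K+1) with r = |t| / (e / 2) bounds the geometric tail. *)
exists (M * 2 / (e / 2) ^+ K.+1).
  by rewrite divr_ge0 ?mulr_ge0 // exprn_ge0 // ltW.
near=> t.
have te : `|t| <= e / 2 / 2 by near: t; apply: near_norm_le; rewrite !divr_gt0.
have cvt : series (fun k => t ^+ k.+1 *: b k.+1) @ \oo --> psi t.
  by apply: cv; lra.
set q := \sum_(_ <= _ < _) _.
have cvq : `|series (fun k => t ^+ k.+1 *: b k.+1) N - q| @[N --> \oo] --> `|psi t - q|.
  by apply: cvg_norm; apply: cvgB cvt _; exact: cvg_cst.
apply: (cvgr_to_le cvq).
near=> N.
have KN : (K <= N)%N by near: N; exact: nbhs_infty_ge.
have -> : q = series (fun k => t ^+ k.+1 *: b k.+1) K by rewrite /q big_add1.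
rewrite sub_series_geq // (le_trans (ler_norm_sum _ _ _)) //.
have r0 : 0 <= `|t| / (e / 2) by rewrite divr_ge0 // ltW.
have r2 : `|t| / (e / 2) <= 2^-1 by rewrite ler_pdivrMr // mulrC.
apply: (@le_trans _ _ (M * (\sum_(K <= k < N) (`|t| / (e / 2)) ^+ k.+1))).
  rewrite mulr_sumr; apply: ler_sum => k _.
  rewrite normrZ normrX expr_div_n mulrA [M * _]mulrC -mulrA.
  rewrite ler_wpM2l ?exprn_ge0 //.
  by rewrite ler_pdivlMr ?exprn_gt0 // mulrC.
rewrite (le_trans (ler_wpM2l M0 (geometric_tail r0 r2 KN))) //.
by rewrite expr_div_n !mulrA mulrAC.
Unshelve. all: by end_near.
Qed.

End Rays.

Section EnergyExpansion.
Variables (R : realType) (n d : nat) (u : forall i, 'cV[R]_(n ^ i)).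
Variables (Phi : 'cV[R]_n -> 'cV[R]_n) (T : forall k : nat, 'M[R]_(n, n ^ k)).
Hypothesis Phi_series : \forall z \near (0 : 'cV[R]_n),
  series (fun k => T k.+1 *m kpow z k.+1) @ \oo --> Phi z.

(** In high degrees [calT] would involve tensors beyond degree K, so the polynomial of degree K
    needs a family that is zero there. *)
Definition truncation K (k : nat) : 'M[R]_(n, n ^ k) :=
  if (k <= K)%N then T k else 0.

Lemma near_ray (P : 'cV[R]_n -> Prop) z :
  (\forall y \near (0 : 'cV[R]_n), P y) -> \forall t \near (0 : R), P (t *: z).
Proof.
move=> P0; have : t *: z @[t --> (0 : R)] --> (0 : 'cV[R]_n).
  by rewrite -[X in _ --> X](scale0r z); apply: cvgZr_tmp; exact: cvg_id.
by apply.
Qed.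

(** Truncating Phi at degree K moves the point by O(t^(K+1)) inside a ball of radius O(t), so
    [poly_energy_lipschitz] gives O(t^(K+2)). *)
Lemma energy_along_ray z K : exists2 C, 0 <= C &
  \forall t \near (0 : R), `|poly_energy d u (Phi (t *: z)) -
    2^-1 * (\poly_(l < (d * K).+1) hcoef (truncation K) u d l z).[t]|
    <= C * `|t| ^+ K.+2.
Proof.
pose b k := T k *m kpow z k.
have Pz : \forall t \near (0 : R),
    series (fun k => t ^+ k.+1 *: b k.+1) @ \oo --> Phi (t *: z).
  apply: filterS (near_ray z Phi_series) => t.
  have -> // : (fun k => T k.+1 *m kpow (t *: z) k.+1) = (fun k => t ^+ k.+1 *: b k.+1).
  by apply/funext => k; rewrite kpowZ -scalemxAr.
(* The remainder of order 0 bounds Phi (t z) itself by C0 |t|. *)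
have [C0 C00 H0] := power_series_remainder Pz 0.
have [C1 C10 H1] := power_series_remainder Pz K.
have [C2 C20 H2] := poly_energy_lipschitz d u.
have c0 : 0 < C0 + C1 + 1 by rewrite ltr_wpDl ?addr_ge0.
exists (C2 * C1 * (C0 + C1)); first by rewrite !mulr_ge0 ?addr_ge0.
near=> t.
have t1 : `|t| <= 1 by near: t; exact: near_norm_le.
(* The Lipschitz bound is applied with radius (C0 + C1) |t|, which must be at most 1. *)
have ts : (C0 + C1) * `|t| <= 1.
  have : `|t| <= (C0 + C1 + 1)^-1 by near: t; apply: near_norm_le; rewrite invr_gt0.
  rewrite -(ler_pM2l c0) mulfV ?gt_eqF //; apply: le_trans.
  by rewrite ler_wpM2r // lerDl.
have -> : 2^-1 * (\poly_(l < (d * K).+1) hcoef (truncation K) u d l z).[t] =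
    poly_energy d u (\sum_(1 <= k < K.+1) t ^+ k *: b k).
  have -> : \sum_(1 <= k < K.+1) t ^+ k *: b k =
      \sum_(1 <= k < K.+1) truncation K k *m kpow (t *: z) k.
    rewrite !big_nat; apply: eq_bigr => k /andP[_ kK].
    by rewrite kpowZ -scalemxAr /truncation -ltnS kK.
  rewrite poly_energy_truncated_series; last first.
    by move=> k Kk; rewrite /truncation leqNgt Kk.
  congr (_ * _); rewrite horner_poly; apply: eq_bigr => l _.
  by rewrite hcoefZ mulrC.
have Hq : `|Phi (t *: z) - \sum_(1 <= k < K.+1) t ^+ k *: b k| <= C1 * `|t| ^+ K.+1.
  by near: t.
have HP : `|Phi (t *: z)| <= C0 * `|t|.
  have : `|Phi (t *: z) - \sum_(1 <= k < 1) t ^+ k *: b k| <= C0 * `|t| ^+ 1.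
    by near: t.
  by rewrite big_geq // subr0 expr1.
set q := \sum_(_ <= _ < _) _ in Hq *.
have t_ge0 := normr_ge0 t.
have HP' : `|Phi (t *: z)| <= (C0 + C1) * `|t|.
  by rewrite (le_trans HP) // ler_wpM2r // lerDl.
have Hq' : `|q| <= (C0 + C1) * `|t|.
  have -> : q = Phi (t *: z) - (Phi (t *: z) - q) by rewrite opprB addrC subrK.
  rewrite (le_trans (ler_normB _ _)) // mulrDl lerD // (le_trans Hq) //.
  by rewrite ler_wpM2l // exprS ler_piMr // exprn_ile1.
rewrite (le_trans (H2 _ _ _ ts HP' Hq')) //.
have -> : C2 * C1 * (C0 + C1) * `|t| ^+ K.+2 =
  C2 * (C1 * `|t| ^+ K.+1) * ((C0 + C1) * `|t|) by rewrite exprSr; ring.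
by rewrite ler_wpM2r ?mulr_ge0 ?addr_ge0 // ler_wpM2l.
Unshelve. all: by end_near.
Qed.

End EnergyExpansion.

(** * Coefficient identities for the transformed energy *)

Section Coefficients.
Variables (R : realType) (n d : nat) (v : forall i, 'cV[R]_(n ^ i)).
Hypothesis v_deg : forall i, (d < i)%N -> v i = 0.

Lemma hcoef2 (T : forall k : nat, 'M[R]_(n, n ^ k)) z :
  hcoef T v d 2 z =
  (z^T *m ((T 1%N : 'M[R]_n)^T *m quad_mx v *m (T 1%N : 'M[R]_n)) *m z) 0 0.
Proof.
rewrite hcoef_deg // big_nat1 calT2_kpow pair_big_dep /=.
have l1 : (1 < 3)%N by [].
rewrite (big_pred1 (Ordinal l1, Ordinal l1)) /=; last first.
  move=> [[i i3] [j j3]]; rewrite /= xpair_eqE -!val_eqE /=; lia.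
by rewrite !T1_kpow1 trmx_mul !mulmxA.
Qed.

(** Input-normality of the linear part reads T_1^-1 = T_1^T V_2, which turns the cross terms of
    [degree_part] into T_1^-1 T_k. *)
Lemma hcoefS (T : forall k : nat, 'M[R]_(n, n ^ k)) k z :
  (quad_mx v)^T = quad_mx v -> (2 <= k)%N ->
  (T 1%N : 'M[R]_n)^T *m quad_mx v *m (T 1%N : 'M[R]_n) = 1%:M ->
  hcoef T v d k.+1 z =
  2 * (z^T *m (invmx (T 1%N : 'M[R]_n) *m T k + 2^-1 *: (Mmx T v k)^T)
       *m kpow z k) 0 0.
Proof.
move=> Vs k2 inV; have Tu : (T 1%N : 'M[R]_n) \in unitmx by case/mulmx1_unit: inV.
have -> : invmx (T 1%N : 'M[R]_n) = (T 1%N : 'M[R]_n)^T *m quad_mx v.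
  by rewrite -[RHS](mulmxK Tu) inV mul1mx.
rewrite hcoef_deg // degree_part // !mulmxDr !mulmxDl -!scalemxAr -!scalemxAl !mulmxA.
move: (_ *m T k *m _) (_ *m (Mmx T v k)^T *m _) => X Y.
by rewrite !mxE mulrDr mulVKf ?pnatr_eq0.
Qed.

Variables (Phi : 'cV[R]_n -> 'cV[R]_n) (T : forall k : nat, 'M[R]_(n, n ^ k)).
Hypothesis Phi_series : \forall z \near (0 : 'cV[R]_n),
  series (fun k => T k.+1 *m kpow z k.+1) @ \oo --> Phi z.
Hypothesis d_ge2 : (2 <= d)%N.

(** The [s i] are only continuous at 0, so the prescribed energy has no Taylor coefficients to
    compare with. Instead both sides are divided by t^2 on the ray t z and t tends to 0; the
    truncation at K = 1 has error O(t^3). The cases s = 1 and s_i = xi_i^2 serve the past and the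
    future energy. *)
Lemma diagonal_linear_part (s : 'I_n -> R -> R) :
  (quad_mx v)^T = quad_mx v ->
  (forall i, {for 0, continuous (s i)}) ->
  (\forall z \near (0 : 'cV[R]_n), poly_energy d v (Phi z) =
     2^-1 * \sum_i s i (z i 0) * z i 0 ^+ 2) ->
  (T 1%N : 'M[R]_n)^T *m quad_mx v *m (T 1%N : 'M[R]_n) = diag_mx (\row_i s i 0).
Proof.
move=> Vs sc H; apply: sym_form_inj.
- by rewrite !trmx_mul trmxK Vs mulmxA.
- exact: tr_diag_mx.
move=> z; rewrite -hcoef2.
have [C C0 HC] := energy_along_ray d v Phi_series z 1.
set p := \poly_(_ < _) _ in HC.
pose sz t := \sum_i s i (t * z i 0) * z i 0 ^+ 2.
have -> : (z^T *m diag_mx (\row_i s i 0) *m z) 0 0 = sz 0.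
  rewrite mul_mx_diag mxE; apply: eq_bigr => i _.
  by rewrite !mxE mul0r; ring.
have szc : sz t @[t --> (0 : R)^'] --> sz 0.
  apply: (@cvg_dnbhs R R).
  apply: (@cvg_big R _ +%R 0 xpredT (@add_continuous R) R (nbhs (0 : R))
    (index_enum 'I_n)
    (fun i t => s i (t * z i 0) * z i 0 ^+ 2)
    (fun i => s i (0 * z i 0) * z i 0 ^+ 2)) => i _.
  apply: cvgM; last exact: cvg_cst.
  have zc : t * z i 0 @[t --> (0 : R)] --> (0 * z i 0 : R).
    by apply: cvgM; [exact: cvg_id | exact: cvg_cst].
  by apply: (cvg_comp _ (s i) zc); rewrite mul0r; exact: sc.
(* The homogeneous parts of degree below 2 are zero, so X^2 divides [p]. *)
pose q := \poly_(l < d * 1) p`_l.+2.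
have pq : p = q * 'X^2.
  apply/polyP => i; rewrite coefMXn !coef_poly.
  case: i => [|[|i]] /=; try by rewrite hcoef_lt2 // if_same.
  rewrite !subSS subn0 !ltnS.
  by case: ifP => [/ltnW ->|_] //; case: ifP.
have q0 : q.[0] = hcoef T v d 2 z.
  rewrite horner_coef0 coef_poly coef_poly ltnS muln1 d_ge2 (ltnW d_ge2).
  by apply: eq_hcoef => -[|[|]].
have qc : q.[t] @[t --> (0 : R)^'] --> (q.[0] : R).
  by apply: (@cvg_dnbhs R R); exact: continuous_horner.
rewrite -q0; apply/eqP; rewrite -subr_eq0 -normr_le0.
apply: (@ler_cvg_to _ ((0 : R)^') _ _ (fun t => `|q.[t] - sz t|)
  (fun t => C * 2 * `|t|)).
- by apply: cvg_norm; apply: cvgB.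
- have : C * 2 * `|t| @[t --> (0 : R)^'] --> C * 2 * `|0 : R|.
    apply: cvgM; first exact: cvg_cst.
    by apply: (@cvg_dnbhs R R); apply: cvg_norm; exact: cvg_id.
  by rewrite normr0 mulr0.
near=> t; have t0 : t != 0 by near: t; exact: nbhs_dnbhs_neq.
have : `|2^-1 * (sz t * t ^+ 2) - 2^-1 * p.[t]| <= C * `|t| ^+ 3.
  suff <- : poly_energy d v (Phi (t *: z)) = 2^-1 * (sz t * t ^+ 2).
    by near: t; exact: nbhs_dnbhs HC.
  have -> : sz t * t ^+ 2 = \sum_i s i ((t *: z) i 0) * (t *: z) i 0 ^+ 2.
    by rewrite mulr_suml; apply: eq_bigr => i _; rewrite !mxE exprMn; ring.
  by near: t; apply: nbhs_dnbhs (near_ray z H).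
rewrite pq hornerM hornerXn -mulrBr -mulrBl 2!normrM normrX distrC.
have -> : C * `|t| ^+ 3 = C * `|t| * `|t| ^+ 2 by ring.
rewrite mulrA ler_pM2r ?exprn_gt0 ?normr_gt0 //.
rewrite ger0_norm ?invr_ge0 // -ler_pdivlMl ?invr_gt0 // invrK.
by rewrite mulrCA mulrA mulrAC.
Unshelve. all: by end_near.
Qed.

(** On each ray the prescribed energy is a multiple of t^2, so [poly_flat_coef] at order k + 2
    applies to the difference of polynomials and kills the coefficient of degree k + 1, which is not
    2. *)
Lemma input_normal_hcoef k z : (2 <= k)%N ->
  (\forall z \near (0 : 'cV[R]_n), poly_energy d v (Phi z) =
     2^-1 * \sum_i z i 0 ^+ 2) ->
  hcoef T v d k.+1 z = 0.
Proof.
move=> k2 H.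
have [C C0 HC] := energy_along_ray d v Phi_series z k.
set p := \poly_(_ < _) _ in HC.
pose c : R := \sum_i z i 0 ^+ 2.
have flat : \forall t \near (0 : R)^',
    `|(2^-1 *: (c *: 'X^2 - p)).[t]| <= C * `|t| ^+ k.+2.
  have HH := near_ray z H.
  apply: nbhs_dnbhs; apply: filterS2 HH HC => t -> .
  suff -> : \sum_i (t *: z) i 0 ^+ 2 = c * t ^+ 2.
    by rewrite -mulrBr !hornerE.
  by rewrite mulr_suml; apply: eq_bigr => i _; rewrite mxE exprMn mulrC.
have := poly_flat_coef flat (leqnn k.+2).
rewrite coefZ coefB coefZ coefXn coef_poly.
(* The degree k + 1 lies in the range of [p] because d and k are at least 2. *)
have -> : (k.+1 < (d * k).+1)%N.
  rewrite ltnS; apply: leq_trans (_ : 2 * k <= _)%N; first lia.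
  by rewrite leq_mul2r d_ge2 orbT.
have -> : (k.+1 == 2)%N = false by lia.
rewrite mulr0 sub0r => /eqP; rewrite mulf_eq0 oppr_eq0 invr_eq0 pnatr_eq0 /=.
move=> /eqP <-; apply: eq_hcoef => j /andP[j0 jk].
by rewrite /truncation -ltnS jk.
Qed.

End Coefficients.

(** The parts of degree 3 to K + 1 vanish by [hcoefS] and the recursion, and the part of degree 2 is
    z^T z. What remains is finitely many parts of degree at least K + 2, each bounded on the unit
    ball by a multiple of |z|^(K+2). *)
Lemma input_normal_seriesP (R : realType) (n d : nat) (v : forall i, 'cV[R]_(n ^ i))
    (T : forall k : nat, 'M[R]_(n, n ^ k)) :
  (forall i, (d < i)%N -> v i = 0) -> (2 <= d)%N -> (quad_mx v)^T = quad_mx v ->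
  (T 1%N : 'M[R]_n)^T *m quad_mx v *m (T 1%N : 'M[R]_n) = 1%:M ->
  (forall k, (2 <= k)%N ->
     T k = - 2^-1 *: ((T 1%N : 'M[R]_n) *m (Mmx T v k)^T)) ->
  input_normal_series (poly_energy d v) T.
Proof.
move=> v_deg d_ge2 Vs inV TE K.
have Tu : (T 1%N : 'M[R]_n) \in unitmx by case/mulmx1_unit: inV.
have ET z : poly_energy d v (\sum_(1 <= k < K.+1) T k *m kpow z k) =
    2^-1 * \sum_(l < (d * K).+1) hcoef (truncation T K) v d l z.
  rewrite -poly_energy_truncated_series => [|k Kk]; last first.
    by rewrite /truncation leqNgt Kk.
  congr poly_energy; rewrite !big_nat; apply: eq_bigr => k /andP[_ kK].
  by rewrite /truncation -ltnS kK.
have sqE (z : 'cV[R]_n) : \sum_i z i 0 ^+ 2 = (z^T *m z) 0 0.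
  by rewrite mxE; apply: eq_bigr => i _; rewrite mxE expr2.
(* For K = 0 the truncated series is empty, and the claim reduces to z^T z <= n |z|^2 for the
   maximum norm. *)
case: K ET => [|K] ET.
  exists n%:R; near=> z; rewrite ET muln0 big_ord1 hcoef_lt2 // mulr0 sub0r normrN sqE.
  have z2 : `|(z^T *m z) 0 0| <= n%:R * `|z| ^+ 2.
    rewrite -sqE (le_trans (ler_norm_sum _ _ _)) //.
    have -> : n%:R * `|z| ^+ 2 = \sum_(i < n) `|z| ^+ 2.
      by rewrite sumr_const card_ord mulr_natl.
    by apply: ler_sum => i _; rewrite normrX lerXn2r ?nnegrE ?norm_entry.
  rewrite normrM (le_trans _ z2) // ler_piMl // ger0_norm ?invr_ge0 //.
  by rewrite invf_le1 // ler1n.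
have ex_bound l : exists c, 0 <= c /\
    forall z, `|hcoef (truncation T K.+1) v d l z| <= c * `|z| ^+ l.
  by have [c c0 Hc] := hcoef_bound (truncation T K.+1) v d l; exists c.
have [C /all_and2[C0 HC]] := boolp.choice ex_bound.
exists (\sum_(l < (d * K.+1).+1) C l); near=> z.
have z1 : `|z| <= 1.
  near: z; apply/nbhs_ballP; exists 1 => [/=|z]; first exact: ltr01.
  by rewrite -ball_normE /= sub0r normrN => /ltW.
have l2 : (2 < (d * K.+1).+1)%N by rewrite ltnS mulnS; apply: leq_trans (leq_addr _ _).
(* The truncation is now at degree K + 1, hence invisible up to degree K + 2. *)
have hT l : (l < K.+3)%N -> hcoef (truncation T K.+1) v d l z = hcoef T v d l z.
  move=> lK; apply: eq_hcoef => j /andP[_ jl].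
  by rewrite /truncation -ltnS (leq_trans jl).
rewrite ET -mulrBr (bigD1 (Ordinal l2)) //= hT // hcoef2 // inV mulmx1 -sqE.
rewrite addrAC subrr add0r.
rewrite normrM; apply: (@le_trans _ _ (1 * `|\sum_(l < (d * K.+1).+1 | l != Ordinal l2)
    hcoef (truncation T K.+1) v d l z|)).
  by rewrite ler_pM // ger0_norm ?invr_ge0 // invf_le1 // ler1n.
rewrite mul1r (le_trans (ler_norm_sum _ _ _)) // mulr_suml big_mkcond /=.
apply: ler_sum => l _; case: ifP => [l2'|_]; last by rewrite mulr_ge0 // exprn_ge0.
have [lK|Kl] := ltnP l K.+3; last first.
  rewrite (le_trans (HC _ _)) // ler_wpM2l // -(subnKC Kl) exprD.
  by rewrite ler_piMr ?exprn_ge0 // exprn_ile1.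
rewrite hT //; case: l l2' lK => -[|[|[|l]]] /= ll l2' lK.
- by rewrite hcoef_lt2 // normr0 mulr_ge0 // exprn_ge0.
- by rewrite hcoef_lt2 // normr0 mulr_ge0 // exprn_ge0.
- by [].
(* The recursion says exactly that the matrix in [hcoefS] is zero. *)
rewrite hcoefS // (TE l.+2) // -scalemxAr mulKmx // -scalerDl addNr scale0r.
by rewrite mulmx0 mul0mx mxE mulr0 normr0 mulr_ge0 // exprn_ge0.
Unshelve. all: by end_near.
Qed.

(** * Construction of the series and form of an arbitrary transformation *)

Theorem theorem2 (R : realType) (n m p : nat)
    (f : 'cV[R]_n -> 'cV[R]_n) (g : 'cV[R]_n -> 'M[R]_(n, m))
    (h : 'cV[R]_n -> 'cV[R]_p) (A : 'M[R]_n) (C : 'M[R]_(p, n)) (gamma : R)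
    (Em Ep : 'cV[R]_n -> R) (d : nat) (v w : forall i : nat, 'cV[R]_(n ^ i))
    (L Rf U Xi V : 'M[R]_n)
    (gamma_gt0 : 0 < gamma) (gamma_neq1 : gamma != 1)
    (eq0 : isolated_equilibrium f)
    (lin : linearization f h A C)
    (Em_past : forall x, is_past_energy f g h gamma x (Em x))
    (Ep_future : forall x, is_future_energy f g h gamma x (Ep x))
    (d_ge2 : (2 <= d)%N)
    (v_sym : forall i, symmetric_coef (v i))
    (w_sym : forall i, symmetric_coef (w i))
    (v_deg : forall i, (d < i)%N -> v i = 0)
    (w_deg : forall i, (d < i)%N -> w i = 0)
    (EmE : forall x, Em x = poly_energy d v x)
    (EpE : forall x, Ep x = poly_energy d w x)
    (V2_pd : posdef (quad_mx v)) (W2_pd : posdef (quad_mx w))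
    (V2_are : filter_are_stabilizing g gamma A C (invmx (quad_mx v)))
    (W2_are : control_are_stabilizing g gamma A C (quad_mx w))
    (W2_chol : quad_mx w = L *m L^T) (V2_chol : quad_mx v = Rf *m Rf^T)
    (svd : is_svd (L^T *m invmx Rf^T) U Xi V) :
  [/\
    (* the matrix built from the computed factorizations *)
    linear_part (quad_mx v) (quad_mx w) L Rf U Xi V (invmx Rf^T *m V),
    (* the series with this linear part and the higher-degree tensors T k
       solves the input-normal coefficient matching *)
    exists T : forall k : nat, 'M[R]_(n, n ^ k),
      [/\ (T 1%N : 'M[R]_n) = invmx Rf^T *m V,
          forall k, (2 <= k)%N ->
            T k = - 2^-1 *: ((T 1%N : 'M[R]_n) *m (Mmx T v k)^T) &
          input_normal_series Em T] &
    (* every input-normal/output-diagonal transformation is of this form, up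
       to terms N invisible to the matching of polynomial coefficients *)
    forall (Phi : 'cV[R]_n -> 'cV[R]_n) (T : forall k : nat, 'M[R]_(n, n ^ k))
           (xi : 'I_n -> R -> R),
      iod_transformation Em Ep Phi T xi ->
      let Xi0 := diag_mx (\row_i xi i 0) in
      exists U0 V0 : 'M[R]_n,
        [/\ is_svd (L^T *m invmx Rf^T) U0 Xi0 V0,
            linear_part (quad_mx v) (quad_mx w) L Rf U0 Xi0 V0 (T 1%N) &
            forall k, (2 <= k)%N ->
              exists N : 'M[R]_(n, n ^ k),
                T k = - 2^-1 *: ((T 1%N : 'M[R]_n) *m (Mmx T v k)^T)
                      + (T 1%N : 'M[R]_n) *m N
                /\ forall z : 'cV[R]_n, z^T *m N *m kpow z k = 0]].
Proof.
have [Vs _] := V2_pd; have [Ws _] := W2_pd.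
have Em_poly : Em = poly_energy d v by apply/funext.
have Ep_poly : Ep = poly_energy d w by apply/funext.
have lin1 := svd_linear_part V2_pd W2_pd W2_chol V2_chol svd.
split; first exact: lin1.
  pose T1 : 'M[R]_n := invmx Rf^T *m V.
  (* Index 0 gets a default value, since the expansion of Phi starts in degree 1. *)
  pose F (T : forall k, 'M[R]_(n, n ^ k)) k : 'M[R]_(n, n ^ k) :=
    match k with
    | 0 => 0
    | 1 => T1
    | k'.+2 => - 2^-1 *: (T1 *m (Mmx T v k'.+2)^T)
    end.
  have [T TF] : exists T, forall k, T k = F T k.
    apply: exists_series => T T' [|[|k]] H; [by [] | by [] |].
    rewrite /F (@eq_Mmx _ _ T T') // => j /andP[_]; exact: H.
  have T1E : (T 1%N : 'M[R]_n) = T1 by rewrite TF.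
  have TE k : (2 <= k)%N -> T k = - 2^-1 *: ((T 1%N : 'M[R]_n) *m (Mmx T v k)^T).
    by move=> k2; rewrite T1E TF; case: k k2 => [|[|k]].
  exists T; split=> //; rewrite Em_poly; apply: input_normal_seriesP => //.
  by rewrite T1E; case: lin1.
move=> Phi T xi [Tu Phi_series xi0 EmP EpP] Xi0.
rewrite Em_poly in EmP; rewrite Ep_poly in EpP.
have inV : (T 1%N : 'M[R]_n)^T *m quad_mx v *m (T 1%N : 'M[R]_n) = 1%:M.
  rewrite (diagonal_linear_part v_deg Phi_series d_ge2 (s := fun _ _ => 1)) //.
  - by apply/matrixP => i j; rewrite !mxE.
  - by move=> i; apply: cst_continuous.
  apply: filterS EmP => z ->; congr (_ * _).
  by apply: eq_bigr => i _; rewrite mul1r.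
have outW : (T 1%N : 'M[R]_n)^T *m quad_mx w *m (T 1%N : 'M[R]_n) = Xi0 *m Xi0.
  rewrite (diagonal_linear_part w_deg Phi_series d_ge2 (s := fun i t => xi i t ^+ 2)) //.
  - rewrite /Xi0 mul_diag_mx; apply/matrixP => i j; rewrite !mxE.
    by rewrite mulrnAr expr2; case: eqP.
  - move=> i; have [xic _] := xi0 i.
    by rewrite /continuous_at; apply: cvgM.
have Xid : is_diag_mx Xi0 by apply: diag_mx_is_diag.
have Xi_ge0 i : 0 <= Xi0 i i by rewrite !mxE eqxx mulr1n; case: (xi0 i).
(* The diagonal of [Xi0] may list the singular values in another order than [Xi], so a decomposition
   with [Xi0] is rebuilt from T_1. *)
have [U0 [V0 [svd0 T1E]]] :=
  linear_part_svd V2_pd W2_pd W2_chol V2_chol Xid Xi_ge0 Tu inV outW.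
exists U0, V0; split; first exact: svd0.
  by rewrite {1}T1E; exact: svd_linear_part.
(* N is the deviation of T_1^-1 T_k from - unvec(M_k)^T / 2. By [hcoefS], 2 z^T N z^(k) is the
   coefficient of degree k + 1, which [input_normal_hcoef] shows to be zero. *)
move=> k k2; exists (invmx (T 1%N : 'M[R]_n) *m T k + 2^-1 *: (Mmx T v k)^T); split.
  by rewrite mulmxDr mulKVmx // -scalemxAr addrCA -scalerDl addNr scale0r addr0.
move=> z; apply/matrixP => i j; rewrite !ord1 [RHS]mxE.
have := input_normal_hcoef Phi_series d_ge2 z k2 EmP.
rewrite (hcoefS v_deg z Vs k2 inV) => /eqP; rewrite mulf_eq0 pnatr_eq0 /= => /eqP.
by [].
Qed.
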